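(* Suppose Assumptions 1–5 (stated in the context) hold. For all agents $i\in\mathcal V$ take any finite (possibly empty) $\overline Y_i^0\subset Y_i$ and proper initial restriction parameters $\varepsilon_i^0>0$. Then for every iteration $k+1>0$ of the distributed upper bounding procedure, $\sum_{i=1}^m f_i(\overline x_i^{k+1})\ge F^*$.
   Context: **Problem.** Let $\mathcal V=\{1,\dots,m\}$ be a set of agents. The distributed robust convex optimization problem (DRCO) is $$\min_{x\in\mathbb R^n} F(x)=\sum_{i=1}^m f_i(x)\quad\text{s.t. } g_i(x,y_i)\le 0\ \ \forall y_i\in Y_i,\ i=1,\dots,m,$$ where $Y_i\subseteq\mathbb R^{n_y}$ is non-empty and compact, $f_i:\mathbb R^n\to\mathbb R$ is convex, and $g_i:\mathbb R^n\times Y_i\to\mathbb R$ is convex in $x$ and continuous in $y_i$. Let $X_i=\{x: g_i(x,y_i)\le 0\ \forall y_i\in Y_i\}$ (convex and compact by standing assumption), $X=\bigcap_{i=1}^m X_i$, and let $F^*$ be the optimal value of (DRCO). **Communication.** At time slot $t$ agents communicate over a directed graph $\mathcal G(t)$ on vertex set $\mathcal V$. **Assumption 1.** $X\neq\emptyset$ and $F$ is strictly convex on $\mathbb R^n$; (DRCO) is solvable with a unique optimal solution $x^*$. **Assumption 2 (uniformly strong connectivity).** There is an integer $T>0$ such that for all $t\ge0$ the graph on $\mathcal V$ whose edge set is the union of the edge sets of $\mathcal G(t),\dots,\mathcal G(t+T-1)$ is strongly connected. **Assumption 3.** There is $x_0$ with $g_i(x_0,y_i)<0$ for all $y_i\in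 Y_i$, $i=1,\dots,m$. **Assumption 4.** For distributed convex optimization problems with finitely many inequality constraints under uniformly strongly connected networks, the decision variables of all agents reach an optimal consensus solution within finitely many time slots. In particular, in each iteration of the procedure below, all agents obtain one and the same optimal solution of the approximation problem. **Assumption 5.** For each $i$ and each iteration, at each query point $\hat x_i$ the problem $\max_{y_i\in Y_i}g_i(\hat x_i,y_i)$ is globally solved, either establishing that the maximum is $\le 0$ or furnishing $\hat y_i$ with $g_i(\hat x_i,\hat y_i)>0$. **Distributed upper bounding procedure** (with reduction parameter $r>1$). For $k=0,1,2,\dots$: every agent obtains the optimal solution $z_i^{k+1}=z^{k+1}$ of $$(\mathrm{DUBD}^k)\quad \min_x F(x)\ \text{ s.t. } g_i(x,y_i)\le -\varepsilon_i^k\ \forall y_i\in\overline Y_i^k,\ i=1,\dots,m.$$ If $\max_{y_i\in Y_i}g_i(z_i^{k+1},y_i)>0$, put $\overline Y_i^{k+1}=\overline Y_i^k\cup\{\hat y_i\}$ with $\hat y_i\in\arg\max_{y_i\in Y_i}g_i(z_i^{k+1},y_i)$, $\varepsilon_i^{k+1}=\varepsilon_i^k$, and let $\overline x_i^{k+1}$ be a formal value with $f_i(\overline x_i^{k+1})=+\infty$; otherwise put $\overline Y_i^{k+1}=\overline Y_i^k$, $\varepsilon_i^{k+1}=\varepsilon_i^k/r$, $\overline x_i^{k+1}=z_i^{k+1}$. **Proper parameters.** The $\varepsilon_i^0>0$ are called proper if they are chosen so that the feasible set of $(\mathrm{DUBD}^k)$ is non-empty in every iteration (such values exist under Assumption 3).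 *)

(* Defs.v *)
From HB Require Import structures.
From mathcomp Require Import all_boot all_order all_algebra.
From mathcomp Require Import all_classical all_reals all_analysis.

Set Implicit Arguments.
Unset Strict Implicit.
Unset Printing Implicit Defensive.

Import Order.TTheory GRing.Theory Num.Theory.
Import numFieldNormedType.Exports.

Local Open Scope classical_set_scope.
Local Open Scope ring_scope.
Local Open Scope convex_scope.

Definition strictly_convex_function (R : realType) (n : nat)
    (f : convex_lmodType 'rV[R]_n -> R^o) : Prop :=
  forall (t : {i01 R}) (x y : convex_lmodType 'rV[R]_n),
    0 < t%:num < 1 -> x != y -> (f (x <| t |> y) < f x <| t |> f y)%R.

Definition is_argmin (R : realType) (T : Type) (D : set T) (h : T -> R) (x : T) :
  Prop := D x /\ forall x', D x' -> h x <= h x'.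

Definition is_argmax (R : realType) (T : Type) (D : set T) (h : T -> R) (x : T) :
  Prop := D x /\ forall x', D x' -> h x' <= h x.

(* A pair (h, b) in [constraints P i] stands for the constraint h x <= b of
   agent i. *)
Record dist_problem (R : realType) (m n : nat) := DistProblem {
  cost : 'I_m -> 'rV[R]_n -> R;
  constraints : 'I_m -> set (('rV[R]_n -> R) * R) }.

Definition total_cost (R : realType) (m n : nat) (f : 'I_m -> 'rV[R]_n -> R)
  (x : 'rV[R]_n) : R := \sum_(i < m) f i x.

Definition dp_feasible (R : realType) (m n : nat) (P : dist_problem R m n) :
    set 'rV[R]_n :=
  [set x | forall i h b, constraints P i (h, b) -> h x <= b].

Definition dp_optimal (R : realType) (m n : nat) (P : dist_problem R m n)
    (x : 'rV[R]_n) : Prop :=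
  is_argmin (dp_feasible P) (total_cost (cost P)) x.

Definition finite_dist_convex (R : realType) (m n : nat)
    (P : dist_problem R m n) : Prop :=
  forall i, [/\ convex_function setT (cost P i),
    finite_set (constraints P i) &
    forall h b, constraints P i (h, b) -> convex_function setT h].

(* [G t a b] means that (a, b) is an edge of the graph at time slot t. *)
Definition uniformly_strongly_connected (m : nat) (G : nat -> rel 'I_m) : Prop :=
  exists2 T : nat, (0 < T)%N & forall (t : nat) (i j : 'I_m),
    connect (fun a b => [exists s : 'I_T, G (t + s)%N a b]) i j.

(* A distributed algorithm is represented by its set of possible executions on a
   given problem and network; an execution [w] gives the decision variable
   [w t i] of agent i after t time slots.  Being a set, it leaves room for
   arbitrary initial states and nondeterminism. *)
Definition dist_algorithm (R : realType) (m n : nat) :=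
  dist_problem R m n -> (nat -> rel 'I_m) -> set (nat -> 'I_m -> 'rV[R]_n).

(* Only problems that possess an optimal solution are considered: the
   requirement is contradictory for the others. *)
Definition finite_time_consensus (R : realType) (m n : nat)
    (A : dist_algorithm R m n) : Prop :=
  forall (P : dist_problem R m n) (G : nat -> rel 'I_m)
         (w : nat -> 'I_m -> 'rV[R]_n),
    finite_dist_convex P -> dp_optimal P !=set0 ->
    uniformly_strongly_connected G -> A P G w ->
    exists z N, dp_optimal P z /\ forall t i, (N <= t)%N -> w t i = z.

(* [dr_g D i x y] is meaningful only for [y] in [dr_Y D i]. *)
Record drco (R : realType) (m n ny : nat) := DRCO {
  dr_f : 'I_m -> 'rV[R]_n -> R;
  dr_g : 'I_m -> 'rV[R]_n -> 'rV[R]_ny -> R;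
  dr_Y : 'I_m -> set 'rV[R]_ny }.

Definition dr_Xi (R : realType) (m n ny : nat) (D : drco R m n ny) (i : 'I_m) :
    set 'rV[R]_n :=
  [set x | forall y, dr_Y D i y -> dr_g D i x y <= 0].

Definition dr_X (R : realType) (m n ny : nat) (D : drco R m n ny) :
    set 'rV[R]_n :=
  \bigcap_i dr_Xi D i.

Definition dr_F (R : realType) (m n ny : nat) (D : drco R m n ny) :
  'rV[R]_n -> R := total_cost (dr_f D).

Definition dr_Fstar (R : realType) (m n ny : nat) (D : drco R m n ny) : \bar R :=
  ereal_inf [set (dr_F D x)%:E | x in dr_X D].

(* The maximum of [dr_g D i x] over the non-empty compact set [dr_Y D i], on
   which it is continuous. *)
Definition dr_gmax (R : realType) (m n ny : nat) (D : drco R m n ny) (i : 'I_m)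
  (x : 'rV[R]_n) : R := sup [set dr_g D i x y | y in dr_Y D i].

Definition drco_standing (R : realType) (m n ny : nat) (D : drco R m n ny) :
    Prop :=
  forall i, [/\ dr_Y D i !=set0 /\ compact (dr_Y D i),
    convex_function setT (dr_f D i),
    forall y, dr_Y D i y -> convex_function setT (fun x => dr_g D i x y),
    forall x, {within dr_Y D i, continuous (dr_g D i x)} &
    convex_set (dr_Xi D i) /\ compact (dr_Xi D i)].

Definition solvable_strictly_convex (R : realType) (m n ny : nat)
    (D : drco R m n ny) : Prop :=
  [/\ dr_X D !=set0, strictly_convex_function (dr_F D) &
    exists! x, is_argmin (dr_X D) (dr_F D) x].

Definition slater_point (R : realType) (m n ny : nat) (D : drco R m n ny) :
    Prop :=
  exists x0, forall i y, dr_Y D i y -> dr_g D i x0 y < 0.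

(* Data generated by an execution of the upper bounding procedure.  Index k+1 of
   [up_z] and [up_xbar] is produced in iteration k; their index 0 is unused.
   In [up_xbar], [None] is the formal value at which every f_i equals +oo.
   [up_slots k] is the number of communication time slots used by iteration k,
   [up_traj k] is the execution of the distributed algorithm in it.
   [up_answer k i] is what agent i gets from its maximization problem at the
   query point [up_z k.+1 i]: [None] is the certificate that the maximum is
   nonpositive, [Some y] is a violating point. *)
Record ub_run (R : realType) (m n ny : nat) := UBRun {
  up_z : nat -> 'I_m -> 'rV[R]_n;
  up_xbar : nat -> 'I_m -> option 'rV[R]_n;
  up_Ybar : nat -> 'I_m -> set 'rV[R]_ny;
  up_eps : nat -> 'I_m -> R;
  up_answer : nat -> 'I_m -> option 'rV[R]_ny;
  up_slots : nat -> nat;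
  up_traj : nat -> nat -> 'I_m -> 'rV[R]_n }.

Definition dubd (R : realType) (m n ny : nat) (D : drco R m n ny)
    (S : ub_run R m n ny) (k : nat) : dist_problem R m n :=
  DistProblem (dr_f D)
    (fun i => [set ((fun x => dr_g D i x y), - up_eps S k i) |
               y in up_Ybar S k i]).

Definition up_start (R : realType) (m n ny : nat) (S : ub_run R m n ny)
  (k : nat) : nat := (\sum_(l < k) up_slots S l)%N.

Definition ub_procedure (R : realType) (m n ny : nat) (D : drco R m n ny)
    (A : dist_algorithm R m n) (G : nat -> rel 'I_m) (r : R)
    (S : ub_run R m n ny) : Prop :=
  forall k : nat,
    [/\ A (dubd D S k) (fun t => G (up_start S k + t)%N) (up_traj S k),
        forall i, up_z S k.+1 i = up_traj S k (up_slots S k) i &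
        forall i,
          if 0 < dr_gmax D i (up_z S k.+1 i) then
            exists y, [/\ up_answer S k i = Some y,
              is_argmax (dr_Y D i) (dr_g D i (up_z S k.+1 i)) y,
              up_Ybar S k.+1 i = up_Ybar S k i `|` [set y],
              up_eps S k.+1 i = up_eps S k i &
              up_xbar S k.+1 i = None]
          else
            [/\ up_Ybar S k.+1 i = up_Ybar S k i,
              up_eps S k.+1 i = up_eps S k i / r &
              up_xbar S k.+1 i = Some (up_z S k.+1 i)]].

Definition consensus_in_iterations (R : realType) (m n ny : nat) (D : drco R m n ny)
    (A : dist_algorithm R m n) (S : ub_run R m n ny) : Prop :=
  finite_time_consensus A /\
  forall k, exists2 z, dp_optimal (dubd D S k) z & forall i, up_z S k.+1 i = z.

Definition globally_solved (R : realType) (m n ny : nat) (D : drco R m n ny)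
    (S : ub_run R m n ny) : Prop :=
  forall k i,
    match up_answer S k i with
    | None => dr_gmax D i (up_z S k.+1 i) <= 0
    | Some y => dr_Y D i y /\ 0 < dr_g D i (up_z S k.+1 i) y
    end.

Definition proper_parameters (R : realType) (m n ny : nat) (D : drco R m n ny)
    (S : ub_run R m n ny) : Prop :=
  (forall i, 0 < up_eps S 0%N i) /\ forall k, dp_feasible (dubd D S k) !=set0.

Definition f_ext (R : realType) (m n ny : nat) (D : drco R m n ny) (i : 'I_m)
    (x : option 'rV[R]_n) : \bar R :=
  if x is Some x' then (dr_f D i x')%:E else +oo%E.

(* Main.v *)
Require Import Defs.
From mathcomp Require Import all_boot all_order all_algebra.
From mathcomp Require Import all_classical all_reals all_analysis.
Import Order.TTheory GRing.Theory Num.Theory.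
Import numFieldNormedType.Exports.
Local Open Scope classical_set_scope.
Local Open Scope ring_scope.

(** An upper bound is +oo as soon as one agent finds its robust constraint
violated, since no f_i ever takes the value -oo, and then nothing has to be
compared.  Otherwise every agent keeps its own point, and consensus makes these
points one single z.  Each agent has certified that the supremum of g_i z over
Y_i is at most 0; compactness of Y_i and continuity of g_i z make this supremum
finite, so that the certificate really bounds every value of g_i z
(lemma [dr_gmax_le0]).  Hence z is feasible for the whole robust problem, and
its total cost is one of the values over which F* is the infimum. *)

(** The supremum of an unbounded set is 0 by convention, which would make the
certificate [dr_gmax D i x <= 0] worthless; compactness and continuity exclude
this case. *)
Lemma dr_gmax_le0 (R : realType) (m n ny : nat) (D : drco R m n ny)
    (i : 'I_m) (x : 'rV[R]_n) :
  compact (dr_Y D i) -> {within dr_Y D i, continuous (dr_g D i x)} ->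
  dr_gmax D i x <= 0 -> dr_Xi D i x.
Proof.
move=> cY cg gmax_le0 y Yy; apply: le_trans gmax_le0.
apply: ub_le_sup; last by exists y.
have [|c _ cmax] := compact_EVT_max _ cY cg; first by exists y.
by exists (dr_g D i x c) => _ [y' Yy' <-]; apply: cmax; rewrite inE.
Qed.

Lemma dr_Fstar_le (R : realType) (m n ny : nat) (D : drco R m n ny)
    (x : 'rV[R]_n) :
  dr_X D x -> (dr_Fstar D <= (dr_F D x)%:E)%E.
Proof. by move=> Xx; apply: ereal_inf_lbound; exists x. Qed.

Lemma sum_f_ext_None (R : realType) (m n ny : nat) (D : drco R m n ny)
    (xbar : 'I_m -> option 'rV[R]_n) (i : 'I_m) :
  xbar i = None -> (\sum_(j < m) f_ext D j (xbar j) = +oo)%E.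
Proof.
move=> xbar_i; apply/esum_eqyP => [j _|].
  by rewrite /f_ext; case: (xbar j).
by exists i; rewrite mem_index_enum xbar_i.
Qed.

Theorem proposition3 (R : realType) (m n ny : nat) (D : drco R m n ny)
    (A : dist_algorithm R m n) (G : nat -> rel 'I_m) (r : R)
    (S : ub_run R m n ny) :
  drco_standing D ->
  solvable_strictly_convex D ->
  uniformly_strongly_connected G ->
  slater_point D ->
  consensus_in_iterations D A S ->
  globally_solved D S ->
  1 < r ->
  (forall i, finite_set (up_Ybar S 0%N i) /\ up_Ybar S 0%N i `<=` dr_Y D i) ->
  proper_parameters D S ->
  ub_procedure D A G r S ->
  forall k : nat,
    (dr_Fstar D <= \sum_(i < m) f_ext D i (up_xbar S k.+1 i))%E.
Proof.
move=> standing _ _ _ [_ consensus] _ _ _ _ procedure k.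
have [z _ zE] := consensus k.
have [_ _ update] := procedure k.
have [/existsP[i gmax_gt0]|] := boolP [exists i, 0 < dr_gmax D i z].
  have := update i; rewrite zE gmax_gt0 => -[y [_ _ _ _ xbar_i]].
  by rewrite (sum_f_ext_None _ _ _ _ _ _ _ xbar_i) leey.
rewrite negb_exists => /forallP no_violation.
have xbarE i : up_xbar S k.+1 i = Some z.
  by have := update i; rewrite zE (negbTE (no_violation i)) => -[].
under eq_bigr do rewrite xbarE /=.
rewrite sumEFin; apply: dr_Fstar_le => i _.
have [[_ cY] _ _ cg _] := standing i.
by apply: dr_gmax_le0; rewrite // leNgt no_violation.
Qed.
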